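(* Let $\Bbbk$ be a field, let $\mathcal A=\{H_1,\dots,H_n\}$ be a central arrangement of $n$ distinct linear hyperplanes in $\mathbb C^\ell$ with underlying matroid $\mathfrak G$, and let $k\ge 1$ be an integer. Then $$\mathcal R_k(\mathcal A,\Bbbk)=\bigcup_{\Gamma\in \mathcal N(\mathfrak G,\Bbbk)} V_k(\Gamma,\Bbbk).$$
   Context: Write $[n]=\{1,\dots,n\}$. The matroid $\mathfrak G$ is the matroid on $[n]$ whose circuits are the minimal sets $C\subseteq[n]$ with $\operatorname{codim}(\bigcap_{i\in C}H_i)<|C|$. The Orlik-Solomon algebra $A=A_\Bbbk(\mathfrak G)$ is the quotient of the exterior algebra over $\Bbbk$ on degree-one generators $e_1,\dots,e_n$ by the ideal generated by all $\partial e_C=\sum_{j=1}^p(-1)^{j-1}e_{i_1}\cdots\hat e_{i_j}\cdots e_{i_p}$, for $C=\{i_1,\dots,i_p\}$ a circuit. The image of $e_i$ in $A$ is $a_i$. For $\xi\in\Bbbk^n$ put $a_\xi=\sum_i\xi_ia_i$. For $\lambda\in\Bbbk^n$ let $Z(\lambda,\Bbbk)=\{\eta\in\Bbbk^n: a_\lambda a_\eta=0\}$. For $k\geq 1$, $\mathcal R_k(\mathcal A,\Bbbk)=\{\lambda\in\Bbbk^n:\dim_\Bbbk Z(\lambda,\Bbbk)\ge k+1\}$. A line of $\mathfrak G$ is a rank-two flat, i.e. a set $\{m\in[n]: H_m\supseteq H_i\cap H_j\}$ with $i\ne j$; $\mathcal X(\mathfrak G)$ is the set of lines, and $\mathcal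 X_0(\mathfrak G)$ is the set of lines $X$ with $|X|\ge3$ (nontrivial lines). For $S\subseteq[n]$ and $\xi\in\Bbbk^n$, $\xi_S=\sum_{i\in S}\xi_i$. Let $\Gamma$ be a (simple) graph with vertex set $[n]$. A clique is a set of pairwise adjacent vertices; a block is a maximal clique; a cone vertex is a vertex adjacent to every other vertex. Let $U$ be the set of non-cone vertices of $\Gamma$. $\Gamma$ is $\mathfrak G$-neighborly if for every $X\in\mathcal X(\mathfrak G)$ with $|X\cap U|\ge 2$ and every block $S$ of $\Gamma$, $|X\cap U\cap S|\ge|X\cap U|-1$ implies $X\subseteq S$. Let $\mathcal X_\Gamma(\mathfrak G)=\{X\in\mathcal X_0(\mathfrak G): X\text{ is not a clique of }\Gamma\}$ and $K(\Gamma,\Bbbk)=\{\xi\in\Bbbk^n:\xi_X=0\text{ for every }X\in\mathcal X_\Gamma(\mathfrak G)\}$. For $\lambda\in K(\Gamma,\Bbbk)$ let $Z_\Gamma(\lambda,\Bbbk)=\{\eta\in K(\Gamma,\Bbbk):\lambda_i\eta_j-\lambda_j\eta_i=0\text{ for every edge }\{i,j\}\text{ of }\Gamma\}$, a linear subspace. $\mathcal N(\mathfrak G,\Bbbk)$ is the set of $\mathfrak G$-neighborly graphs $\Gamma$ with vertex set $[n]$ and $\dim K(\Gamma,\Bbbk)\ge2$. For $\Gamma\in\mathcal N(\mathfrak G,\Bbbk)$, $V_k(\Gamma,\Bbbk)=\{\lambda\in K(\Gamma,\Bbbk):\dim_\Bbbk Z_\Gamma(\lambda,\Bbbk)\ge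 k+1\}$. *)

(* Defs.v *)
From HB Require Import structures.
From mathcomp Require Import classical_sets reals.
From mathcomp Require Import all_boot all_order all_algebra.
From mathcomp Require Import complex.
From mathcomp Require Import zify.

Set Implicit Arguments.
Unset Strict Implicit.
Unset Printing Implicit Defensive.

Import GRing.Theory.
Local Open Scope ring_scope.
Local Open Scope quotient_scope.

Section ShuffleSign.
Variables (k : fieldType) (n : nat).
Implicit Types S T W : {set 'I_n}.

Definition inversions S T : nat := \sum_(s in S) \sum_(t in T) (t < s)%N.

(* For increasing monomials, e_S * e_T = shuffle_sign S T *: e_(S :|: T). *)
Definition shuffle_sign S T : k :=
  if [disjoint S & T] then (-1) ^+ inversions S T else 0.

Lemma shuffle_sign0l T : shuffle_sign set0 T = 1.
Proof. by rewrite /shuffle_sign /inversions big_set0 -setI_eq0 set0I eqxx. Qed.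

Lemma shuffle_sign0r S : shuffle_sign S set0 = 1.
Proof.
rewrite /shuffle_sign /inversions; under eq_bigr do rewrite big_set0.
by rewrite big1 // -setI_eq0 setI0 eqxx.
Qed.

Lemma sum_setU_disjoint (F : 'I_n -> nat) S T : [disjoint S & T] ->
  (\sum_(i in S :|: T) F i = \sum_(i in S) F i + \sum_(i in T) F i)%N.
Proof.
move=> dST; rewrite -bigU //=; apply: eq_bigl => i; rewrite !inE //.
Qed.

Lemma shuffle_signA S T W :
  shuffle_sign S T * shuffle_sign (S :|: T) W =
  shuffle_sign T W * shuffle_sign S (T :|: W).
Proof.
rewrite /shuffle_sign -!setI_eq0 setIUl setIUr !setU_eq0 !setI_eq0.
have [dST|_] := boolP [disjoint S & T]; last by rewrite mul0r mulr0.
have [dSW|_] := boolP [disjoint S & W]; last by rewrite !mulr0.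
have [dTW|_] /= := boolP [disjoint T & W]; last by rewrite mulr0 mul0r.
rewrite -!exprD; congr (_ ^+ _); rewrite /inversions sum_setU_disjoint //.
under [X in _ = (_ + X)%N]eq_bigr do rewrite sum_setU_disjoint //.
by rewrite big_split /=; lia.
Qed.

End ShuffleSign.

(* An element is its coordinate family on the increasing monomials e_S; the
   product is [ext_mul] below, and [ext_basis_prod] relates e_S to the e_i. *)
Definition extalg (k : fieldType) (n : nat) : Type := {ffun {set 'I_n} -> k^o}.

Section Exterior.
Variables (k : fieldType) (n : nat).
Local Notation E := (extalg k n).
Implicit Types (S T W : {set 'I_n}) (x y z : E).

HB.instance Definition _ := Vector.on E.

Definition ext_basis S : E := [ffun T => (T == S)%:R].

Definition ext_mul_def x y : E :=
  \sum_S \sum_T (x S * y T * shuffle_sign k S T) *: ext_basis (S :|: T).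
Fact ext_mul_key : unit. Proof. by []. Qed.
Definition ext_mul := locked_with ext_mul_key ext_mul_def.

Lemma ext_mulE x y : ext_mul x y =
  \sum_S \sum_T (x S * y T * shuffle_sign k S T) *: ext_basis (S :|: T).
Proof. by rewrite /ext_mul unlock. Qed.

Lemma ext_basis_sum x : x = \sum_S x S *: ext_basis S.
Proof.
apply/ffunP=> T; rewrite sum_ffunE (bigD1 T) //= big1 => [|S neST].
  by rewrite !ffunE eqxx addr0 -[_ *: _]/(_ * _) mulr1.
by rewrite !ffunE eq_sym (negPf neST) scaler0.
Qed.

Lemma ext_mulDl : left_distributive ext_mul +%R.
Proof.
move=> x y z; rewrite !ext_mulE -big_split; apply: eq_bigr => S _ /=.
rewrite -big_split; apply: eq_bigr => T _ /=.
by rewrite ffunE !mulrDl scalerDl.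
Qed.

Lemma ext_mulDr : right_distributive ext_mul +%R.
Proof.
move=> x y z; rewrite !ext_mulE -big_split; apply: eq_bigr => S _ /=.
rewrite -big_split; apply: eq_bigr => T _ /=.
by rewrite ffunE mulrDr mulrDl scalerDl.
Qed.

Lemma ext_scalerAl (a : k) x y : a *: ext_mul x y = ext_mul (a *: x) y.
Proof.
rewrite !ext_mulE scaler_sumr; apply: eq_bigr => S _.
rewrite scaler_sumr; apply: eq_bigr => T _.
by rewrite scalerA !ffunE -[_ *: x S]/(_ * _) !mulrA.
Qed.

Lemma ext_scalerAr (a : k) x y : a *: ext_mul x y = ext_mul x (a *: y).
Proof.
rewrite !ext_mulE scaler_sumr; apply: eq_bigr => S _.
rewrite scaler_sumr; apply: eq_bigr => T _.
by rewrite scalerA !ffunE -[_ *: y T]/(_ * _) !mulrA [x S * a]mulrC.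
Qed.

Lemma ext_mul0l y : ext_mul 0 y = 0.
Proof. by rewrite -[in LHS](scale0r (0 : E)) -ext_scalerAl scale0r. Qed.

Lemma ext_mul0r x : ext_mul x 0 = 0.
Proof. by rewrite -[in LHS](scale0r (0 : E)) -ext_scalerAr scale0r. Qed.

Lemma ext_mul_suml I (r : seq I) (P : pred I) (F : I -> E) y :
  ext_mul (\sum_(i <- r | P i) F i) y = \sum_(i <- r | P i) ext_mul (F i) y.
Proof. by apply: (big_morph (ext_mul^~ y)) => [x z|]; rewrite (ext_mulDl, ext_mul0l). Qed.

Lemma ext_mul_sumr I (r : seq I) (P : pred I) (F : I -> E) x :
  ext_mul x (\sum_(i <- r | P i) F i) = \sum_(i <- r | P i) ext_mul x (F i).
Proof. by apply: (big_morph (ext_mul x)) => [y z|]; rewrite (ext_mulDr, ext_mul0r). Qed.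

Lemma ext_mul_basis S T :
  ext_mul (ext_basis S) (ext_basis T) = shuffle_sign k S T *: ext_basis (S :|: T).
Proof.
rewrite !ext_mulE (bigD1 S) //= [X in _ + X]big1 ?addr0 => [|S' neS]; last first.
  by rewrite big1 // => T' _; rewrite ffunE (negPf neS) !mul0r scale0r.
rewrite (bigD1 T) //= [X in _ + X]big1 ?addr0 => [|T' neT].
  by rewrite !ffunE !eqxx !mul1r.
by rewrite [ext_basis T T']ffunE (negPf neT) mulr0 mul0r scale0r.
Qed.

Lemma ext_mulA : associative ext_mul.
Proof.
move=> x y z; rewrite (ext_basis_sum x) !ext_mul_suml; apply: eq_bigr => S _.
rewrite -!ext_scalerAl; congr (_ *: _).
rewrite (ext_basis_sum y) ext_mul_suml !ext_mul_sumr ext_mul_suml.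
apply: eq_bigr => T _.
rewrite -!ext_scalerAl -!ext_scalerAr -!ext_scalerAl; congr (_ *: _).
rewrite (ext_basis_sum z) !ext_mul_sumr; apply: eq_bigr => W _.
rewrite -!ext_scalerAr; congr (_ *: _).
rewrite !ext_mul_basis -ext_scalerAl -ext_scalerAr !ext_mul_basis !scalerA.
by rewrite setUA shuffle_signA.
Qed.

Lemma ext_mul1l : left_id (ext_basis set0) ext_mul.
Proof.
move=> x; rewrite {1}(ext_basis_sum x) ext_mul_sumr [RHS]ext_basis_sum.
apply: eq_bigr => S _.
by rewrite -ext_scalerAr ext_mul_basis shuffle_sign0l scale1r set0U.
Qed.

Lemma ext_mul1r : right_id (ext_basis set0) ext_mul.
Proof.
move=> x; rewrite {1}(ext_basis_sum x) ext_mul_suml [RHS]ext_basis_sum.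
apply: eq_bigr => S _.
by rewrite -ext_scalerAl ext_mul_basis shuffle_sign0r scale1r setU0.
Qed.

Lemma ext_basis0_neq0 : ext_basis set0 != 0.
Proof. by apply/eqP => /ffunP/(_ set0)/eqP; rewrite !ffunE eqxx oner_eq0. Qed.

HB.instance Definition _ := GRing.Zmodule_isNzRing.Build E
  ext_mulA ext_mul1l ext_mul1r ext_mulDl ext_mulDr ext_basis0_neq0.
HB.instance Definition _ := GRing.Lmodule_isLalgebra.Build k E ext_scalerAl.
HB.instance Definition _ := GRing.Lalgebra_isAlgebra.Build k E ext_scalerAr.

Definition ext_gen (i : 'I_n) : E := ext_basis [set i].

Lemma ext_gen_sqr i : ext_gen i * ext_gen i = 0.
Proof.
rewrite [LHS]ext_mul_basis /shuffle_sign disjoints1 inE eqxx scale0r //.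
Qed.

Lemma ext_gen_anticomm i j : ext_gen i * ext_gen j = - (ext_gen j * ext_gen i).
Proof.
have [->|neij] := eqVneq i j; first by rewrite ext_gen_sqr oppr0.
rewrite [LHS]ext_mul_basis [ext_gen j * _]ext_mul_basis setUC -scaleNr.
congr (_ *: _); rewrite /shuffle_sign !disjoints1 !inE [j == i]eq_sym (negPf neij).
rewrite /inversions !big_set1.
by case: ltngtP neij => [||/val_inj->]; rewrite ?eqxx // expr0 expr1 ?opprK.
Qed.

(* [enum S] lists the elements of S in increasing order. *)
Lemma ext_basis_prod S : ext_basis S = \prod_(i <- enum S) ext_gen i.
Proof.
have: sorted (fun i j : 'I_n => (i < j)%N) (enum S).
  rewrite {1}/enum_mem; apply: sorted_filter; first by move=> ? ? ?; apply: ltn_trans.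
  rewrite -enumT.
  have := iota_ltn_sorted 0 n; rewrite -val_enum_ord sorted_map; exact.
rewrite -[in LHS](set_enum S); elim: (enum S) => [_|i s IHs] /=.
  by rewrite big_nil; congr ext_basis; apply/setP=> j; rewrite !inE.
rewrite path_sortedE => [/andP[/allP lti sts]|? ? ?]; last exact: ltn_trans.
rewrite big_cons -IHs // [RHS]ext_mul_basis /shuffle_sign disjoints1 inE.
have /negPf-> : i \notin s by apply/negP=> /lti; rewrite ltnn.
rewrite /inversions big_set1 big1 => [|j]; last first.
  by rewrite inE => /lti; case: ltngtP.
rewrite scale1r; congr ext_basis; apply/setP=> j; rewrite !inE //.
Qed.

End Exterior.

Section OrlikSolomon.
Variables (k : fieldType) (n : nat) (Cs : {set {set 'I_n}}).
Local Notation E := (extalg k n).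

(* Since [index] starts at 0, the j-th element of C gets the sign (-1)^(j-1). *)
Definition ext_bd (C : {set 'I_n}) : E :=
  \sum_(i in C) (-1) ^+ index i (enum C) *: \prod_(j <- enum (C :\ i)) ext_gen k j.

(* The two-sided ideal generated by the [ext_bd C] for C in Cs; see
   [os_ideal_gen], [os_idealMl], [os_idealMr] and [os_ideal_min]. *)
Definition os_ideal : {vspace E} :=
  (\sum_(C in Cs) \sum_(S : {set 'I_n}) \sum_(T : {set 'I_n})
     <[ext_basis k S * ext_bd C * ext_basis k T]>)%VS.

Lemma os_ideal_mem (C S T : {set 'I_n}) : C \in Cs ->
  ext_basis k S * ext_bd C * ext_basis k T \in os_ideal.
Proof.
move=> CCs; rewrite memvE /os_ideal; apply: (sumv_sup C) => //.
by apply: (sumv_sup S) => //; apply: (sumv_sup T) => //; apply: subvv.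
Qed.

Lemma os_ideal_sub (V : {vspace E}) :
  (forall C S T : {set 'I_n}, C \in Cs ->
     ext_basis k S * ext_bd C * ext_basis k T \in V) -> (os_ideal <= V)%VS.
Proof.
move=> sV; apply/subv_sumP => C CCs; apply/subv_sumP => S _.
by apply/subv_sumP => T _; rewrite -memvE sV.
Qed.

Lemma os_ideal_gen (C : {set 'I_n}) : C \in Cs -> ext_bd C \in os_ideal.
Proof. by move/(os_ideal_mem set0 set0); rewrite mul1r mulr1. Qed.

Lemma os_idealMl (x y : E) : y \in os_ideal -> x * y \in os_ideal.
Proof.
move: y; suff: (os_ideal <= linfun (x \*o idfun) @^-1: os_ideal)%VS.
  by move=> sI y /(subvP sI); rewrite -memv_preim lfunE.
apply: os_ideal_sub => C S T CCs; rewrite -memv_preim lfunE /=.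
rewrite (ext_basis_sum x) mulr_suml memv_suml // => U _.
rewrite -scalerAl memvZ // !mulrA [X in X * _ * _]ext_mul_basis -!scalerAl.
by rewrite memvZ // os_ideal_mem.
Qed.

Lemma os_idealMr (x y : E) : y \in os_ideal -> y * x \in os_ideal.
Proof.
move: y; suff: (os_ideal <= linfun (x \o* idfun) @^-1: os_ideal)%VS.
  by move=> sI y /(subvP sI); rewrite -memv_preim lfunE.
apply: os_ideal_sub => C S T CCs; rewrite -memv_preim lfunE /=.
rewrite (ext_basis_sum x) mulr_sumr memv_suml // => U _.
rewrite -scalerAr memvZ // -!mulrA [X in _ * (_ * X)]ext_mul_basis -!scalerAr.
by rewrite memvZ // mulrA os_ideal_mem.
Qed.

Lemma os_ideal_min (V : {vspace E}) :
  (forall x y : E, y \in V -> x * y \in V) ->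
  (forall x y : E, y \in V -> y * x \in V) ->
  (forall C, C \in Cs -> ext_bd C \in V) -> (os_ideal <= V)%VS.
Proof. by move=> Vl Vr Vg; apply: os_ideal_sub => C S T CCs; rewrite Vr ?Vl ?Vg. Qed.

Definition osalg : Type := Quotient.quot (pred_of_vspace os_ideal).

HB.instance Definition _ := GRing.Zmodule.on osalg.
HB.instance Definition _ := EqQuotient.on osalg.

Definition os_pi (x : E) : osalg := \pi_(osalg) x.

Lemma os_piK (u : osalg) : os_pi (repr u) = u.
Proof. by rewrite /os_pi reprK. Qed.

Lemma os_pi_eq (x y : E) : (os_pi x == os_pi y) = (x - y \in os_ideal).
Proof. by rewrite [RHS](Quotient.idealrBE (pred_of_vspace os_ideal)). Qed.

Lemma os_piB : zmod_morphism os_pi.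
Proof.
move=> x y; rewrite /os_pi (Quotient.pi_add (pred_of_vspace os_ideal)).
by rewrite (Quotient.pi_opp (pred_of_vspace os_ideal)).
Qed.
HB.instance Definition _ := GRing.isZmodMorphism.Build E osalg os_pi os_piB.

Lemma os_pi_eq0 (x : E) : (os_pi x == 0) = (x \in os_ideal).
Proof. by rewrite -[x in RHS]subr0 -os_pi_eq raddf0. Qed.

Definition os_scale (a : k) (u : osalg) : osalg := os_pi (a *: repr u).
Definition os_mul (u v : osalg) : osalg := os_pi (repr u * repr v).

Lemma repr_os_pi (x : E) : repr (os_pi x) - x \in os_ideal.
Proof. by rewrite -os_pi_eq os_piK. Qed.

Lemma os_scaleE (a : k) (x : E) : os_scale a (os_pi x) = os_pi (a *: x).
Proof. by apply/eqP; rewrite os_pi_eq -scalerBr memvZ ?repr_os_pi. Qed.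

Lemma os_mulE (x y : E) : os_mul (os_pi x) (os_pi y) = os_pi (x * y).
Proof.
apply/eqP; rewrite os_pi_eq -[X in X - _](subrK (x * repr (os_pi y))).
rewrite -addrA -mulrBl -mulrBr memvD //.
  by rewrite os_idealMr ?repr_os_pi.
by rewrite os_idealMl ?repr_os_pi.
Qed.

Lemma os_scaleA (a b : k) (u : osalg) : os_scale a (os_scale b u) = os_scale (a * b) u.
Proof. by rewrite -(os_piK u) !os_scaleE scalerA. Qed.

Lemma os_scale1 : left_id 1 os_scale.
Proof. by move=> u; rewrite -(os_piK u) os_scaleE scale1r. Qed.

Lemma os_scaleDr : right_distributive os_scale +%R.
Proof.
by move=> a u v; rewrite -(os_piK u) -(os_piK v) -raddfD !os_scaleE scalerDr raddfD.
Qed.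

Lemma os_scaleDl (u : osalg) : {morph os_scale^~ u : a b / a + b}.
Proof. by move=> a b; rewrite -(os_piK u) !os_scaleE scalerDl raddfD. Qed.

HB.instance Definition _ := GRing.Zmodule_isLmodule.Build k osalg
  os_scaleA os_scale1 os_scaleDr os_scaleDl.

Lemma os_mulA : associative os_mul.
Proof.
by move=> u v w; rewrite -(os_piK u) -(os_piK v) -(os_piK w) !os_mulE mulrA.
Qed.

Lemma os_mul1l : left_id (os_pi 1) os_mul.
Proof. by move=> u; rewrite -(os_piK u) os_mulE mul1r. Qed.

Lemma os_mul1r : right_id (os_pi 1) os_mul.
Proof. by move=> u; rewrite -(os_piK u) os_mulE mulr1. Qed.

Lemma os_mulDl : left_distributive os_mul +%R.
Proof.
move=> u v w; rewrite -(os_piK u) -(os_piK v) -(os_piK w).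
by rewrite -raddfD !os_mulE mulrDl raddfD.
Qed.

Lemma os_mulDr : right_distributive os_mul +%R.
Proof.
move=> u v w; rewrite -(os_piK u) -(os_piK v) -(os_piK w).
by rewrite -raddfD !os_mulE mulrDr raddfD.
Qed.

(* Only a [pzRingType]: for a general Cs the ideal may contain 1. *)
HB.instance Definition _ := GRing.Zmodule_isPzRing.Build osalg
  os_mulA os_mul1l os_mul1r os_mulDl os_mulDr.

Lemma os_piM (x y : E) : os_pi (x * y) = os_pi x * os_pi y.
Proof. by rewrite -os_mulE. Qed.

Lemma os_piZ (a : k) (x : E) : os_pi (a *: x) = a *: os_pi x.
Proof. by rewrite -os_scaleE. Qed.

Lemma os_scalerAl (a : k) (u v : osalg) : a *: (u * v) = (a *: u) * v.
Proof. by rewrite -(os_piK u) -(os_piK v) -os_piM -!os_piZ -os_piM scalerAl. Qed.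

Lemma os_scalerAr (a : k) (u v : osalg) : a *: (u * v) = u * (a *: v).
Proof. by rewrite -(os_piK u) -(os_piK v) -os_piM -!os_piZ -os_piM scalerAr. Qed.

Lemma os_vect_iso : Vector.axiom (\dim (os_ideal^C)) osalg.
Proof.
have [f f_lin f_bij] := subvs_vect_iso (os_ideal^C).
pose F := GRing.isLinear.Build _ _ _ _ f f_lin.
pose lf : {linear subvs_of (os_ideal^C) -> 'rV_(\dim (os_ideal^C))} := HB.pack f F.
pose p (x : E) := x - projv os_ideal x.
have pW x : p x \in (os_ideal^C)%VS by exact: memv_projC.
have pI x y : x - y \in os_ideal -> p x = p y.
  move=> xyI; rewrite /p -[x](subrK y); move: (x - y) xyI => d dI.
  by rewrite (linearD (projv os_ideal)) /= (projv_id dI) opprD addrACA subrr add0r.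
have pP a x y : p (a *: x + y) = a *: p x + p y.
  by rewrite /p linearP scalerBr opprD addrACA.
pose h (u : osalg) := lf (vsproj (os_ideal^C) (p (repr u))).
have hE x : h (os_pi x) = lf (vsproj (os_ideal^C) (p x)).
  by rewrite /h (pI _ x) // repr_os_pi.
exists h.
  move=> a u v; rewrite -(os_piK u) -(os_piK v) -os_piZ -raddfD !hE.
  by rewrite pP !linearP.
have [g fK gK] := f_bij; exists (fun r => os_pi (vsval (g r))) => [u|r].
  rewrite -(os_piK u) hE /= fK vsprojK //; apply/eqP.
  by rewrite os_pi_eq /p addrAC subrr add0r rpredN memv_proj.
have /eqP gW : projv os_ideal (vsval (g r)) == 0.
  by rewrite -memv_ker lker_proj subvsP.
by rewrite hE /p gW subr0 vsvalK /= gK.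
Qed.

HB.instance Definition _ := Lmodule_hasFinDim.Build k osalg os_vect_iso.

(* The elements a_i, and a_xi = \sum_i xi_i a_i below. *)
Definition os_gen (i : 'I_n) : osalg := os_pi (ext_gen k i).

Definition os_form (xi : 'rV[k]_n) : osalg := \sum_i xi 0 i *: os_gen i.

Lemma os_form_is_linear : linear os_form.
Proof.
move=> a u v; rewrite /os_form scaler_sumr -big_split; apply: eq_bigr => i _ /=.
by rewrite !mxE scalerDl scalerA.
Qed.
HB.instance Definition _ :=
  GRing.isLinear.Build k 'rV[k]_n osalg _ os_form os_form_is_linear.

(* [linfun f] agrees with f only for linear f; cf. [mem_annihilator]. *)
Definition annihilator (lam : 'rV[k]_n) : {vspace 'rV[k]_n} :=
  lker (linfun (fun eta => os_form lam * os_form eta)).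

Lemma mem_annihilator (lam eta : 'rV[k]_n) :
  (eta \in annihilator lam) = (os_form lam * os_form eta == 0).
Proof.
pose f eta := os_form lam * os_form eta.
have f_lin : linear f.
  by move=> a u v; rewrite /f linearP mulrDr os_scalerAr.
pose lf : {linear 'rV[k]_n -> osalg} :=
  HB.pack f (GRing.isLinear.Build _ _ _ _ f f_lin).
by rewrite memv_ker (lfunE lf).
Qed.

End OrlikSolomon.

Record arrangement (F : fieldType) (l n : nat) := Arrangement {
  hyperplane :> 'I_n -> {vspace 'cV[F]_l};
  hyperplane_codim1 : forall i, (\dim (hyperplane i)).+1 = l;
  hyperplane_inj : injective hyperplane
}.

Section ArrangementMatroid.
Variables (F : fieldType) (l n : nat) (H : arrangement F l n).

Definition codim (V : {vspace 'cV[F]_l}) : nat := l - \dim V.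

Definition circuits : {set {set 'I_n}} :=
  [set C | minset (fun D => codim (\bigcap_(i in D) H i)%VS < #|D|)%N C].

Definition line (i j : 'I_n) : {set 'I_n} := [set m | (H i :&: H j <= H m)%VS].

Definition lines : {set {set 'I_n}} :=
  [set X | [exists i, exists j, (i != j) && (X == line i j)]].

End ArrangementMatroid.

Record graph (n : nat) := Graph {
  adj :> 'I_n -> 'I_n -> bool;
  adj_sym : symmetric adj;
  adj_irr : irreflexive adj
}.

Section Graphs.
Variables (n : nat) (G : graph n).

Definition clique (S : {set 'I_n}) : bool :=
  [forall i in S, forall j in S, (i != j) ==> G i j].

Definition block (S : {set 'I_n}) : bool := maxset clique S.

Definition cone (i : 'I_n) : bool := [forall j, (j != i) ==> G i j].

Definition noncone : {set 'I_n} := [set i | ~~ cone i].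

(* The matroid enters through its set of lines L, trivial ones included. *)
Variable L : {set {set 'I_n}}.

Definition neighborly : Prop :=
  forall X S : {set 'I_n}, X \in L -> (2 <= #|X :&: noncone|)%N -> block S ->
    (#|X :&: noncone| - 1 <= #|X :&: noncone :&: S|)%N -> X \subset S.

Definition nonclique_lines : {set {set 'I_n}} :=
  [set X in L | (3 <= #|X|)%N & ~~ clique X].

Variable k : fieldType.

Definition coord_sum (X : {set 'I_n}) (xi : 'rV[k]_n) : k^o :=
  \sum_(i in X) xi 0 i.

Lemma coord_sum_is_linear X : linear (coord_sum X).
Proof.
move=> a u v; rewrite /coord_sum scaler_sumr -big_split; apply: eq_bigr => i _ /=.
by rewrite !mxE.
Qed.
HB.instance Definition _ X :=
  GRing.isLinear.Build k 'rV[k]_n k^o _ (coord_sum X) (coord_sum_is_linear X).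

Definition Kspace : {vspace 'rV[k]_n} :=
  (\bigcap_(X in nonclique_lines) lker (linfun (coord_sum X)))%VS.

Lemma mem_Kspace (xi : 'rV[k]_n) :
  reflect (forall X, X \in nonclique_lines -> coord_sum X xi = 0)
          (xi \in Kspace).
Proof.
rewrite memvE; apply: (iffP subv_bigcapP) => K0 X /K0.
  by rewrite -memvE memv_ker lfunE => /eqP.
by move=> xiX; rewrite -memvE memv_ker lfunE; apply/eqP.
Qed.

Definition minor2 (lam : 'rV[k]_n) (i j : 'I_n) (eta : 'rV[k]_n) : k^o :=
  lam 0 i * eta 0 j - lam 0 j * eta 0 i.

Lemma minor2_is_linear lam i j : linear (minor2 lam i j).
Proof.
move=> a u v; rewrite /minor2 !mxE scalerBr -![a *: _]/(_ * _).
rewrite !mulrDr opprD addrACA; congr (_ - _ + _); exact: mulrCA.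
Qed.
HB.instance Definition _ lam i j :=
  GRing.isLinear.Build k 'rV[k]_n k^o _ (minor2 lam i j) (minor2_is_linear lam i j).

Definition Zspace (lam : 'rV[k]_n) : {vspace 'rV[k]_n} :=
  (Kspace :&:
   \bigcap_(ij : 'I_n * 'I_n | G ij.1 ij.2) lker (linfun (minor2 lam ij.1 ij.2)))%VS.

Lemma mem_Zspace (lam eta : 'rV[k]_n) :
  reflect (eta \in Kspace /\
           forall i j, G i j -> lam 0 i * eta 0 j - lam 0 j * eta 0 i = 0)
          (eta \in Zspace lam).
Proof.
rewrite memv_cap; apply: (iffP andP) => -[etaK etaZ]; split=> //.
  move=> i j Gij; move: etaZ; rewrite memvE => /subv_bigcapP/(_ (i, j) Gij).
  by rewrite -memvE memv_ker lfunE => /eqP.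
rewrite memvE; apply/subv_bigcapP => -[i j] /etaZ ij0.
by rewrite -memvE memv_ker lfunE; apply/eqP.
Qed.

End Graphs.

Section Resonance.
Local Open Scope classical_set_scope.
Variables (F : fieldType) (l n : nat) (H : arrangement F l n) (k : fieldType).

Definition resonance (r : nat) : set 'rV[k]_n :=
  [set lam | (r.+1 <= \dim (annihilator (circuits H) lam))%N].

Definition neighborly_graphs : set (graph n) :=
  [set G | neighborly G (lines H) /\ (2 <= \dim (Kspace G (lines H) k))%N].

Definition Vset (G : graph n) (r : nat) : set 'rV[k]_n :=
  [set lam | lam \in Kspace G (lines H) k /\
             (r.+1 <= \dim (Zspace G (lines H) lam))%N].

End Resonance.

Arguments resonance {F l n} H k r.
Arguments neighborly_graphs {F l n} H k.
Arguments Vset {F l n} H k G r.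

(* Main.v *)
(* A product a_lam a_eta vanishes iff, for every line X and every i in X,
     lam_X eta_i = eta_X lam_i.                                           (L)
   Indeed the degree-two part of A splits over the lines, and on each line the
   boundary map e_i e_j |-> e_j - e_i is injective modulo the circuit relations.

   Given lam in R_k, let Z be its annihilator and join i and j when
   (lam_i, eta_i) and (lam_j, eta_j) are parallel for all eta in Z.  If X is not
   a clique, (L) forces the sums over X of all members of Z to vanish, so
   Z is contained in K(Gamma).  Parallelism is transitive through noncone
   vertices; if all but one vertex v of X :&: U lie in a block S, then (L) at a
   vertex y of X :&: U :&: S reduces to the minor of v and y, so v is in S.
   Conversely, (L) holds on clique lines by the minors, on nontrivial nonclique
   lines because both sums vanish, and a neighborly graph has every trivial line
   as an edge. *)
From HB Require Import structures.
Require Import Defs.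
From mathcomp Require Import classical_sets reals.
From mathcomp Require Import all_boot all_order all_algebra.
From mathcomp Require Import complex.
From mathcomp Require Import zify ring.

Set Implicit Arguments.
Unset Strict Implicit.
Unset Printing Implicit Defensive.

Import GRing.Theory.
Local Open Scope ring_scope.

(** * Rank-two flats and small circuits of the arrangement *)

Section Lines.
Variables (F : fieldType) (l n : nat) (H : arrangement F l n).
Implicit Types (i j m : 'I_n) (X C : {set 'I_n}).

(** If [H i + H j] were no larger than [H i], then [H j] would lie in [H i] and equal it by
    dimension, against injectivity. So the sum is the whole space, and the dimension formula for sum
    and intersection applies. *)
Lemma dim_hyperplane_cap i j : i != j -> (\dim (H i :&: H j)%VS).+2 = l.
Proof.
move=> neij; have := dimv_sum_cap (H i) (H j).
have := hyperplane_codim1 H i; have := hyperplane_codim1 H j.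
have ltU : (\dim (H i) < \dim (H i + H j)%VS)%N.
  rewrite ltnNge; apply/negP=> leUi.
  have sHji : (H j <= H i)%VS.
    suff /eqP-> : H i == (H i + H j)%VS by exact: addvSr.
    by rewrite eqEdim addvSl.
  move/negP: neij; apply; apply/eqP/(@hyperplane_inj _ _ _ H)/eqP.
  rewrite eq_sym eqEdim sHji /=.
  by have := hyperplane_codim1 H i; have := hyperplane_codim1 H j; lia.
have : (\dim (H i + H j)%VS <= l)%N.
  have dimE : dim 'cV[F]_l = l by rewrite dim_matrix mulr1.
  by rewrite -[X in (_ <= X)%N]dimE -dimvf dimvS ?subvf.
lia.
Qed.

(** One intersection is contained in the other, and both have codimension two. *)
Lemma line_cap_eq X i j p q : X = line H i j -> i != j -> p \in X -> q \in X ->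
  p != q -> (H p :&: H q)%VS = (H i :&: H j)%VS.
Proof.
move=> ->; rewrite !inE => neij Xp Xq nepq; apply/esym/eqP.
rewrite eqEdim subv_cap Xp Xq /=.
have := dim_hyperplane_cap neij; have := dim_hyperplane_cap nepq; lia.
Qed.

Lemma line_in_lines i j : i != j -> line H i j \in lines H.
Proof.
move=> neij; rewrite inE; apply/existsP; exists i.
by apply/existsP; exists j; rewrite neij /=.
Qed.

Lemma mem_line_l i j : i \in line H i j.
Proof. by rewrite inE capvSl. Qed.

Lemma mem_line_r i j : j \in line H i j.
Proof. by rewrite inE capvSr. Qed.

(** Two distinct points determine their line, so the pairs of distinct indices are partitioned by
    the lines. *)
Lemma line_eq X p q : X \in lines H -> p != q ->
  (line H p q == X) = (p \in X) && (q \in X).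
Proof.
rewrite inE => /existsP[i /existsP[j /andP[neij /eqP defX]]] nepq.
apply/eqP/andP=> [<-|[Xp Xq]]; first by rewrite mem_line_l mem_line_r.
by rewrite /line (line_cap_eq defX neij Xp Xq nepq).
Qed.

Lemma codim_setU2 i j : i != j -> codim (\bigcap_(m in [set i; j]) H m)%VS = 2%N.
Proof.
move=> neij; rewrite big_setU1 ?inE //= big_set1 /codim.
have := dim_hyperplane_cap neij; lia.
Qed.

Lemma dependent_card_gt2 C :
  (codim (\bigcap_(m in C) H m)%VS < #|C|)%N -> (2 < #|C|)%N.
Proof.
rewrite ltnNge => ltC; rewrite ltnNge; apply/negP.
case E: #|C| => [|[|[|//]]] _; case/negP: ltC; rewrite E //.
  have /eqP/cards1P[i ->] := E; rewrite big_set1 /codim.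
  have := hyperplane_codim1 H i; lia.
by have /eqP/cards2P[i [j [neij ->]]] := E; rewrite codim_setU2.
Qed.

Lemma circuit_card_gt2 C : C \in circuits H -> (2 < #|C|)%N.
Proof. by rewrite inE => /minsetp/dependent_card_gt2. Qed.

Lemma cards3 i j m : i != j -> j != m -> i != m -> #|[set i; j; m]| = 3%N.
Proof.
move=> neij nejm neim.
by rewrite setUC cardsU1 cards2 neij !inE negb_or ![m == _]eq_sym neim nejm.
Qed.

Lemma bigcap_setU3 i j m : j != m -> i != j -> i != m ->
  (\bigcap_(p in [set i; j; m]) H p = H i :&: H j :&: H m)%VS.
Proof.
move=> nejm neij neim; rewrite -setUA big_setU1 ?inE ?negb_or ?neij //=.
by rewrite big_setU1 ?inE //= big_set1 capvA.
Qed.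

(** The triple is dependent exactly when [H m] contains the codimension-two space [H i :&: H j].
    Minimality is then automatic, since every dependent set has at least three elements. *)
Lemma circuit3E X i j m : X \in lines H -> i != j -> j != m -> i != m ->
  i \in X -> j \in X -> ([set i; j; m] \in circuits H) = (m \in X).
Proof.
move=> linX neij nejm neim Xi Xj.
have /eqP defX : line H i j == X by rewrite line_eq // Xi.
have dimij := dim_hyperplane_cap neij.
rewrite -[in RHS]defX !inE; apply/idP/idP => [/minsetp|/capv_idPl sHm].
  rewrite bigcap_setU3 // cards3 // /codim => codim3.
  apply/capv_idPl/eqP; rewrite eqEdim capvSl; lia.
apply/minsetP; split=> [|B /dependent_card_gt2 B3 sB].
  by rewrite bigcap_setU3 // sHm cards3 // /codim; lia.
by apply/eqP; rewrite eqEcard sB cards3.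
Qed.

End Lines.

(** * Degree-two coefficients in the exterior algebra *)

Section ExteriorDegreeTwo.
Variables (k : fieldType) (n : nat).
Local Notation E := (extalg k n).
Implicit Types (S T W C X : {set 'I_n}) (x y : E) (i j p m : 'I_n).

Lemma ext_mul_coef x y W :
  (x * y) W =
  \sum_(S : {set 'I_n} | S \subset W) x S * y (W :\: S) * shuffle_sign k S (W :\: S).
Proof.
rewrite [x * y]ext_mulE sum_ffunE [RHS]big_mkcond; apply: eq_bigr => S _.
rewrite sum_ffunE; under eq_bigr => T _ do
  rewrite !ffunE -[_ *: _]/(_ * _) /shuffle_sign.
case: ifPn => [sSW | nsSW]; last first.
  rewrite big1 // => T _; case: eqP => [defW|]; last by rewrite mulr0.
  by case/negP: nsSW; rewrite defW subsetUl.
rewrite (bigD1 (W :\: S)) //= [X in _ + X]big1 ?addr0 => [|T neT].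
  have dS : [disjoint S & W :\: S] by rewrite -setI_eq0 setIDA setDIl setDv set0I.
  have -> : S :|: W :\: S = W by rewrite -[RHS](setID W S) (setIidPr sSW).
  by rewrite /shuffle_sign dS eqxx mulr1.
case: ifPn => [dST|]; last by rewrite mulr0 mul0r.
case: eqP => [defW|]; last by rewrite mulr0.
case/eqP: neT; rewrite defW setDUl setDv set0U.
by apply/esym/setDidPl; rewrite disjoint_sym.
Qed.

(** No components in degrees 0 and 1. In a product with such a factor, the coefficients up to degree
    two see only the scalar part of the other factor. *)
Definition order_ge2 x := forall T, (#|T| <= 1)%N -> x T = 0.

Lemma order_ge2_mull x y W : order_ge2 y -> (#|W| <= 2)%N ->
  (x * y) W = x set0 * y W.
Proof.
move=> y2 leW2; rewrite ext_mul_coef (bigD1 set0) ?sub0set //= setD0.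
rewrite shuffle_sign0l mulr1 big1 ?addr0 // => S /andP[sSW neS0].
rewrite y2 ?mulr0 ?mul0r // cardsD (setIidPr sSW).
have : (0 < #|S|)%N by rewrite card_gt0.
lia.
Qed.

Lemma order_ge2_mulr x y W : order_ge2 y -> (#|W| <= 2)%N ->
  (y * x) W = y W * x set0.
Proof.
move=> y2 leW2; rewrite ext_mul_coef (bigD1 W) //= setDv.
rewrite shuffle_sign0r mulr1 big1 ?addr0 // => S /andP[sSW neSW].
rewrite y2 ?mul0r //.
have : (#|S| < #|W|)%N by rewrite proper_card // properEneq neSW.
lia.
Qed.

Lemma order_ge2M x y : order_ge2 y -> order_ge2 (x * y).
Proof.
by move=> y2 T leT1; rewrite order_ge2_mull ?y2 ?mulr0 // (leq_trans leT1).
Qed.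

Local Notation sg i j := (shuffle_sign k [set i] [set j]).

Lemma shuffle_sign1 i j :
  sg i j = if i == j then 0 else (-1) ^+ (j < i)%N.
Proof.
by rewrite /shuffle_sign disjoints1 inE /inversions !big_set1; case: eqP.
Qed.

Lemma ext_gen_mul i j : ext_gen k i * ext_gen k j = sg i j *: ext_basis k [set i; j].
Proof. exact: ext_mul_basis. Qed.

Lemma set2_eq i j p m : p != m ->
  ([set p; m] == [set i; j]) = (p == i) && (m == j) || (p == j) && (m == i).
Proof.
move=> nepm; apply/eqP/orP=> [e|]; last first.
  by case=> /andP[/eqP-> /eqP->] //; rewrite setUC.
have : p \in [set i; j] by rewrite -e set21.
have : m \in [set i; j] by rewrite -e set22.
move: nepm; rewrite !inE => nepm /orP[] /eqP em /orP[] /eqP ep; subst;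
  rewrite ?eqxx in nepm *; by auto.
Qed.

(** The factor [sg p m] turns the coefficient at the unordered set [[set p; m]] into a function
    antisymmetric in [p] and [m] and zero on the diagonal, so later sums need no ordering of
    indices. *)
Lemma ext_gen_mul_coef i j p m :
  sg p m * (ext_gen k i * ext_gen k j) [set p; m] =
  (p == i)%:R * (m == j)%:R - (p == j)%:R * (m == i)%:R.
Proof.
rewrite ext_gen_mul !ffunE -[_ *: _]/(_ * _) mulrA.
rewrite !shuffle_sign1.
case: (eqVneq p m) => [->|nepm]; first by rewrite !mul0r [RHS]addrC mulrC addNr.
rewrite set2_eq //; case: (eqVneq i j) => [->|neij].
  by rewrite mulr0 mul0r subrr.
case: (eqVneq p i) => [->|nepi]; case: (eqVneq m j) => [->|nemj];
  rewrite ?(negPf neij) ?eqxx /= ?mulr0 ?mul0r ?subr0 ?mulr1 ?oppr0 //.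
- by rewrite -expr2 sqrr_sign.
- by rewrite [j == i]eq_sym (negPf neij) andbF !mulr0 subr0.
case: (eqVneq p j) => [->|_] /=; last by rewrite mulr0 mul0r subr0.
case: (eqVneq m i) nepm => [->|_ _] /=; last by rewrite !mulr0 subr0.
rewrite !mulr1 sub0r -exprD; case: ltngtP neij => // /val_inj->.
by rewrite eqxx.
Qed.

Definition ext_form (xi : 'rV[k]_n) : E := \sum_i xi 0 i *: ext_gen k i.

Lemma ext_form_mul_coef (lam eta : 'rV[k]_n) p m :
  sg p m * (ext_form lam * ext_form eta) [set p; m] =
  lam 0 p * eta 0 m - lam 0 m * eta 0 p.
Proof.
rewrite /ext_form mulr_suml sum_ffunE mulr_sumr.
have delta (xi : 'rV[k]_n) (q : 'I_n) : \sum_i xi 0 i * (q == i)%:R = xi 0 q.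
  rewrite (bigD1 q) //= eqxx mulr1 big1 ?addr0 // => i.
  by rewrite eq_sym => /negPf->; rewrite mulr0.
transitivity (\sum_i (lam 0 i * (p == i)%:R * eta 0 m - lam 0 i * (m == i)%:R * eta 0 p)).
  apply: eq_bigr => i _; rewrite mulr_sumr sum_ffunE mulr_sumr.
  rewrite -[in RHS](delta eta m) -[in RHS](delta eta p) !mulr_sumr -sumrB.
  apply: eq_bigr => j _; rewrite -scalerAl -scalerAr !ffunE -![_ *: _]/(_ * _).
  have e := ext_gen_mul_coef i j p m.
  rewrite mulrCA [sg _ _ * _]mulrCA e; ring.
by rewrite sumrB -!mulr_suml !delta.
Qed.

(* For m in X: the e_m-coefficient of the boundary of the part of x supported
   on the pairs contained in X. *)
Definition pencil_form X m x : k^o := \sum_(p in X) sg p m * x [set p; m].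

Lemma pencil_form_is_linear X m : linear (pencil_form X m).
Proof.
move=> a u v; rewrite /pencil_form scaler_sumr -big_split; apply: eq_bigr => p _ /=.
by rewrite !ffunE mulrDr; congr (_ + _); exact: mulrCA.
Qed.
HB.instance Definition _ X m :=
  GRing.isLinear.Build k E k^o _ (pencil_form X m) (pencil_form_is_linear X m).

Lemma pencil_form_gen X m i j :
  pencil_form X m (ext_gen k i * ext_gen k j) =
  (i \in X)%:R * (m == j)%:R - (j \in X)%:R * (m == i)%:R.
Proof.
rewrite /pencil_form; under eq_bigr do rewrite ext_gen_mul_coef.
have delta q : \sum_(p in X) ((p == q)%:R : k) = (q \in X)%:R.
  rewrite big_mkcond (bigD1 q) //= eqxx big1 ?addr0; first by case: ifP.
  by move=> p /negPf->; case: ifP.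
by rewrite sumrB -!mulr_suml !delta.
Qed.

(** Summing the minors over [p] in [X] produces the two sides of (L). *)
Lemma pencil_form_form X m (lam eta : 'rV[k]_n) :
  pencil_form X m (ext_form lam * ext_form eta) =
  coord_sum X lam * eta 0 m - coord_sum X eta * lam 0 m.
Proof.
rewrite /pencil_form; under eq_bigr do rewrite ext_form_mul_coef.
rewrite sumrB -mulr_suml; congr (_ - _).
by rewrite mulr_suml; apply: eq_bigr => i _; rewrite mulrC.
Qed.

Lemma pencil_form_mull X m x y : order_ge2 y ->
  pencil_form X m (x * y) = x set0 * pencil_form X m y.
Proof.
move=> y2; rewrite /pencil_form mulr_sumr; apply: eq_bigr => p _.
by rewrite order_ge2_mull // ?cards2 ?ltnS ?leq_b1 // mulrCA.
Qed.

Lemma pencil_form_mulr X m x y : order_ge2 y ->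
  pencil_form X m (y * x) = pencil_form X m y * x set0.
Proof.
move=> y2; rewrite /pencil_form mulr_suml; apply: eq_bigr => p _.
by rewrite order_ge2_mulr // ?cards2 ?ltnS ?leq_b1 // mulrA.
Qed.

Lemma ext_bdE C : ext_bd k C =
  \sum_(i in C) (-1) ^+ index i (enum C) *: ext_basis k (C :\ i).
Proof. by apply: eq_bigr => i _; rewrite -ext_basis_prod. Qed.

Lemma ext_bd_coef0 C W : #|C| != #|W|.+1 -> ext_bd k C W = 0.
Proof.
move=> neCW; rewrite ext_bdE sum_ffunE big1 // => i Ci; rewrite !ffunE.
case: eqP => [defW|]; last by rewrite scaler0.
by case/eqP: neCW; rewrite defW (cardsD1 i C) Ci.
Qed.

Lemma sorted_enum_set C : sorted (fun i j : 'I_n => (i < j)%N) (enum C).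
Proof.
rewrite {1}/enum_mem; apply: sorted_filter; first by move=> ? ? ?; apply: ltn_trans.
by rewrite -enumT; have := iota_ltn_sorted 0 n; rewrite -val_enum_ord sorted_map.
Qed.

(** Identifies [enum] on explicit sets, so that the [index] signs in [ext_bd] can be computed. *)
Lemma enum_set_sorted C s : sorted (fun i j : 'I_n => (i < j)%N) s -> C =i s -> enum C = s.
Proof.
move=> sS eqCs; apply: (@irr_sorted_eq _ (fun i j : 'I_n => (i < j)%N)) => //.
- by move=> ? ? ?; apply: ltn_trans.
- by move=> i /=; rewrite ltnn.
- exact: sorted_enum_set.
by move=> i; rewrite mem_enum eqCs.
Qed.

Lemma ext_gen_mul_lt i j : (i < j)%N ->
  ext_gen k i * ext_gen k j = ext_basis k [set i; j].
Proof.
move=> ltij; rewrite ext_gen_mul shuffle_sign1 -val_eqE ltn_eqF // ltnNge ltnW //.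
by rewrite scale1r.
Qed.

Lemma ext_bd3 (a b c : 'I_n) : (a < b)%N -> (b < c)%N ->
  ext_bd k [set a; b; c] = ext_gen k b * ext_gen k c - ext_gen k a * ext_gen k c
                           + ext_gen k a * ext_gen k b.
Proof.
move=> ltab ltbc; have ltac := ltn_trans ltab ltbc.
have neab : a == b = false by rewrite -val_eqE ltn_eqF.
have nebc : b == c = false by rewrite -val_eqE ltn_eqF.
have neac : a == c = false by rewrite -val_eqE ltn_eqF.
have enumC : enum [set a; b; c] = [:: a; b; c].
  by apply: enum_set_sorted => [|i]; rewrite /= ?ltab ?ltbc // !inE orbA.
rewrite ext_bdE -big_enum enumC !big_cons big_nil /= addr0 !eqxx neab nebc neac /=.
rewrite !ext_gen_mul_lt // expr0 expr1 sqrrN expr1n !scale1r scaleN1r addrA.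
congr (_ - _ + _); congr (ext_basis k _); apply/setP=> i; rewrite !inE.
- case: (eqVneq i a) => [->|] //=; first by rewrite neab neac.
- case: (eqVneq i b) => [->|] //=; first by rewrite ?orbT eq_sym neab nebc.
  by rewrite orbF.
- case: (eqVneq i c) => [->|] //=; last by rewrite orbF.
  by rewrite ![c == _]eq_sym neac nebc.
Qed.

Lemma card3_sorted C : #|C| = 3%N ->
  exists a b c : 'I_n, [/\ (a < b)%N, (b < c)%N & C = [set a; b; c]].
Proof.
move=> C3; have := sorted_enum_set C.
have := cardE C; rewrite C3; case E: (enum C) => [|a [|b [|c [|//]]]] //= _.
case/and3P=> ltab ltbc _; exists a, b, c; split=> //.
by apply/setP=> i; rewrite -mem_enum E !inE orbA.
Qed.

End ExteriorDegreeTwo.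

(** * The product of two linear forms in the Orlik-Solomon algebra *)

Section ProductOfForms.
Variables (F : fieldType) (l n : nat) (H : arrangement F l n) (k : fieldType).
Implicit Types (i j m : 'I_n) (X : {set 'I_n}) (lam eta : 'rV[k]_n).
Local Notation a := (@os_gen k n (circuits H)).
Local Notation piA := (@os_pi k n (circuits H)).

Lemma os_gen_sqr i : a i * a i = 0.
Proof. by rewrite -os_piM ext_gen_sqr raddf0. Qed.

Lemma os_gen_anticomm i j : a i * a j = - (a j * a i).
Proof. by rewrite -!os_piM ext_gen_anticomm raddfN. Qed.

Lemma os_gen_circuit3 i j m : [set i; j; m] \in circuits H -> (i < j)%N -> (j < m)%N ->
  a i * a j + a j * a m + a m * a i = 0.
Proof.
move=> circ ltij ltjm; have := os_ideal_gen k circ.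
rewrite -os_pi_eq0 ext_bd3 // raddfD raddfB /= !os_piM => /eqP <-.
by rewrite [a m * a i]os_gen_anticomm -addrA addrC.
Qed.

Lemma os_gen_line X i j m : X \in lines H -> i \in X -> j \in X -> m \in X ->
  a i * a j = a i * a m - a j * a m.
Proof.
move=> linX Xi Xj Xm.
have [->|neij] := eqVneq i j; first by rewrite os_gen_sqr subrr.
have [->|neim] := eqVneq i m.
  by rewrite os_gen_sqr sub0r os_gen_anticomm.
have [->|nejm] := eqVneq j m; first by rewrite os_gen_sqr subr0.
suff: a i * a j + a j * a m + a m * a i = 0.
  move/eqP; rewrite -addrA addr_eq0 => /eqP->.
  by rewrite [a m * a i]os_gen_anticomm opprD opprK addrC.
(* The circuit relation is available for increasing triples. Its left side is invariant under
   rotation and changes sign under a transposition, which covers all six orders of [i], [j], [m]. *)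
have circ p q r : p \in X -> q \in X -> r \in X -> (p < q)%N -> (q < r)%N ->
    a p * a q + a q * a r + a r * a p = 0.
  move=> Xp Xq Xr ltpq ltqr; apply: os_gen_circuit3 => //.
  have ltpr := ltn_trans ltpq ltqr.
  by rewrite (circuit3E linX) // -val_eqE ltn_eqF.
have swap p q r : a q * a p + a p * a r + a r * a q = 0 ->
    a p * a q + a q * a r + a r * a p = 0.
  rewrite [a q * a p]os_gen_anticomm [a p * a r]os_gen_anticomm.
  rewrite [a r * a q]os_gen_anticomm -!opprD => /eqP; rewrite oppr_eq0 => /eqP <-.
  by rewrite addrAC.
have rot p q r : a q * a r + a r * a p + a p * a q = 0 ->
    a p * a q + a q * a r + a r * a p = 0.
  by move=> <-; rewrite -addrA addrC.
have [ltij|ltji|/val_inj eij] := ltngtP i j; last by rewrite eij eqxx in neij.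
all: have [ltjm|ltmj|/val_inj ejm] := ltngtP j m; last by rewrite ejm eqxx in nejm.
all: have [ltim|ltmi|/val_inj eim] := ltngtP i m; last by rewrite eim eqxx in neim.
all: try lia.
- exact: circ.
- by apply/swap/rot/circ.
- by do 2 apply/rot; apply: circ.
- exact/swap/circ.
- by apply/rot/circ.
by apply/swap/rot/rot/circ.
Qed.

(** Every product on the line is rewritten through the base point [m]; the coefficients that collect
    are the differences in (L). *)
Lemma line_product X m lam eta : X \in lines H -> m \in X ->
  \sum_(i in X) \sum_(j in X) (lam 0 i * eta 0 j) *: (a i * a j) =
  \sum_(i in X) (lam 0 i * coord_sum X eta - coord_sum X lam * eta 0 i) *: (a i * a m).
Proof.
move=> linX Xm.
transitivity (\sum_(i in X) (\sum_(j in X) (lam 0 i * eta 0 j) *: (a i * a m) -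
                             \sum_(j in X) (lam 0 i * eta 0 j) *: (a j * a m))).
  apply: eq_bigr => i Xi; rewrite -sumrB; apply: eq_bigr => j Xj.
  by rewrite -scalerBr (os_gen_line linX Xi Xj Xm).
under [RHS]eq_bigr do rewrite scalerBl.
rewrite !sumrB; congr (_ - _).
  by apply: eq_bigr => i _; rewrite -scaler_suml mulr_sumr.
by rewrite exchange_big; apply: eq_bigr => i _; rewrite -scaler_suml mulr_suml.
Qed.

Lemma os_form_product lam eta :
  os_form (circuits H) lam * os_form (circuits H) eta =
  \sum_(X in lines H) \sum_(i in X) \sum_(j in X) (lam 0 i * eta 0 j) *: (a i * a j).
Proof.
pose t (ij : 'I_n * 'I_n) := (lam 0 ij.1 * eta 0 ij.2) *: (a ij.1 * a ij.2).
have t0 ij : ij.1 == ij.2 -> t ij = 0.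
  by case: ij => i j /= /eqP->; rewrite /t os_gen_sqr scaler0.
transitivity (\sum_ij t ij).
  rewrite /os_form mulr_suml; under eq_bigr do rewrite mulr_sumr.
  rewrite pair_big; apply: eq_bigr => ij _.
  by rewrite -os_scalerAl -os_scalerAr scalerA.
(* Diagonal pairs span no line, so they are dropped before partitioning. They return below as zero
   terms, completing each line's share to a full double sum. *)
rewrite (bigID (fun ij : 'I_n * 'I_n => ij.1 == ij.2)) big1 //= add0r.
rewrite (partition_big (fun ij => line H ij.1 ij.2) (mem (lines H))) => [|ij]; last first.
  exact: line_in_lines.
apply: eq_bigr => X linX; rewrite pair_big [RHS](bigID (fun ij => ij.1 == ij.2)).
rewrite [X in _ = X + _]big1 ?add0r => [|ij /andP[_ /t0] //].
apply: eq_bigl => ij; have [|ne] := eqVneq ij.1 ij.2; first by rewrite andbF.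
by rewrite andbT line_eq.
Qed.

Lemma os_form_ext lam eta :
  os_form (circuits H) lam * os_form (circuits H) eta =
  piA (ext_form lam * ext_form eta).
Proof.
by rewrite os_piM /ext_form !raddf_sum; congr (_ * _); apply: eq_bigr => i _;
  rewrite /= os_piZ.
Qed.

(** Only circuits of size three have a boundary in degree two. If a line contains two elements of
    such a circuit it contains the third, and this makes the coefficients cancel. *)
Lemma pencil_form_bd X C m : X \in lines H -> m \in X -> C \in circuits H ->
  pencil_form X m (ext_bd k C) = 0.
Proof.
move=> linX Xm circ; have [C3|neC3] := eqVneq #|C| 3%N; last first.
  rewrite /pencil_form big1 // => p _; have [->|nepm] := eqVneq p m.
    by rewrite shuffle_sign1 eqxx mul0r.
  by rewrite ext_bd_coef0 ?mulr0 // cards2 nepm.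
have [p [q [r [ltpq ltqr defC]]]] := card3_sorted C3.
have ltpr := ltn_trans ltpq ltqr; subst C.
have nepq : p != q by rewrite -val_eqE ltn_eqF.
have neqr : q != r by rewrite -val_eqE ltn_eqF.
have nepr : p != r by rewrite -val_eqE ltn_eqF.
rewrite ext_bd3 // linearD linearB /= !pencil_form_gen.
have Xr : p \in X -> q \in X -> r \in X.
  by move=> Xp Xq; rewrite -(circuit3E linX nepq neqr nepr Xp Xq).
have Xq : p \in X -> r \in X -> q \in X.
  move=> Xp Xr'; rewrite -(circuit3E linX nepr _ nepq Xp Xr') 1?eq_sym //.
  by rewrite setUAC.
have Xp : q \in X -> r \in X -> p \in X.
  move=> Xq' Xr'; rewrite -(circuit3E linX neqr _ _ Xq' Xr') 1?eq_sym //.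
  by rewrite setUC setUA.
have [emp|nemp] := eqVneq m p.
  rewrite emp in Xm *; rewrite (negPf nepq) (negPf nepr).
  have -> : (q \in X) = (r \in X) by apply/idP/idP; auto.
  ring.
have [emq|nemq] := eqVneq m q.
  rewrite emq in Xm *; rewrite (negPf neqr).
  have -> : (p \in X) = (r \in X) by apply/idP/idP; auto.
  ring.
have [emr|nemr] := eqVneq m r; last by rewrite !mulr0 !subr0 addr0.
rewrite emr in Xm *; have -> : (p \in X) = (q \in X) by apply/idP/idP; auto.
ring.
Qed.

Lemma order_ge2_bd C : C \in circuits H -> order_ge2 (ext_bd k C).
Proof.
move=> /circuit_card_gt2 C3 T leT1; apply: ext_bd_coef0; apply/eqP => eC.
by move: C3; rewrite eC ltnS ltnNge leT1.
Qed.

(** Circuit boundaries have no terms below degree two, so the basis factors around a generator enter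
    only through their scalar parts, leaving a multiple of the form at the boundary itself. *)
Lemma pencil_form_ideal X m x : X \in lines H -> m \in X ->
  x \in os_ideal k (circuits H) -> pencil_form X m x = 0.
Proof.
move=> linX Xm; suff: (os_ideal k (circuits H) <= lker (linfun (pencil_form X m)))%VS.
  by move=> /subvP sI /sI; rewrite memv_ker lfunE => /eqP.
apply: os_ideal_sub => C S T circ; have C2 := order_ge2_bd circ.
rewrite memv_ker lfunE /= pencil_form_mulr ?pencil_form_mull //; last exact: order_ge2M.
by rewrite pencil_form_bd // mulr0 mul0r.
Qed.

(** This is criterion (L). Necessity holds because the pencil forms vanish on the ideal;
    sufficiency, because a base point on each line makes all coefficients of [line_product] zero. *)
Lemma os_form_mul_eq0P lam eta :
  reflect (forall X i, X \in lines H -> i \in X ->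
             coord_sum X lam * eta 0 i = coord_sum X eta * lam 0 i)
          (os_form (circuits H) lam * os_form (circuits H) eta == 0).
Proof.
apply: (iffP eqP) => [|local].
  rewrite os_form_ext => /eqP; rewrite os_pi_eq0 => I0 X i linX Xi.
  have := pencil_form_ideal linX Xi I0; rewrite pencil_form_form => /eqP.
  by rewrite subr_eq0 => /eqP.
rewrite os_form_product big1 // => X linX.
have [X0|[m Xm]] := set_0Vmem X; first by rewrite X0 big_set0.
rewrite (line_product _ _ linX Xm) big1 // => i Xi.
by rewrite mulrC -(local X i linX Xi) subrr scale0r.
Qed.

End ProductOfForms.

(** * The graph attached to a resonant weight, and both inclusions *)

Section ResonanceGraph.
Variables (F : fieldType) (l n : nat) (H : arrangement F l n) (k : fieldType).
Implicit Types (i j m : 'I_n) (X S : {set 'I_n}) (eta : 'rV[k]_n).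
Variable lam : 'rV[k]_n.
Local Notation Z := (annihilator (circuits H) lam).

Lemma annihilator_line eta X i : eta \in Z -> X \in lines H -> i \in X ->
  coord_sum X lam * eta 0 i = coord_sum X eta * lam 0 i.
Proof. by rewrite mem_annihilator => /os_form_mul_eq0P; apply. Qed.

(** A condition on all of [Z], phrased as an inclusion of subspaces so that it is boolean, as
    adjacency in a [graph] must be. *)
Definition parallel i j : bool := (Z <= lker (linfun (minor2 lam i j)))%VS.

Lemma parallelP i j :
  reflect (forall eta, eta \in Z -> lam 0 i * eta 0 j = lam 0 j * eta 0 i)
          (parallel i j).
Proof.
apply: (iffP subvP) => par eta /par; rewrite memv_ker lfunE /= /minor2.
  by rewrite subr_eq0 => /eqP.
by move=> ->; rewrite subrr.
Qed.

Lemma parallel_sym : symmetric parallel.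
Proof. by move=> i j; apply/parallelP/parallelP => par eta /par. Qed.

Lemma parallel_refl : reflexive parallel.
Proof. by move=> i; apply/parallelP. Qed.

Definition resonance_adj i j : bool := (i != j) && parallel i j.

Lemma resonance_adj_sym : symmetric resonance_adj.
Proof. by move=> i j; rewrite /resonance_adj eq_sym parallel_sym. Qed.

Lemma resonance_adj_irr : irreflexive resonance_adj.
Proof. by move=> i; rewrite /resonance_adj eqxx. Qed.

Definition resonance_graph : graph n := Graph resonance_adj_sym resonance_adj_irr.

Lemma resonance_cliqueP S :
  reflect {in S &, forall i j, parallel i j} (clique resonance_graph S).
Proof.
apply: (iffP forall_inP) => [cl i j Si Sj|par i Si].
  have [->|neij] := eqVneq i j; first exact: parallel_refl.
  by have /forall_inP/(_ j Sj) := cl i Si; rewrite /= /resonance_adj neij.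
by apply/forall_inP => j Sj; apply/implyP => neij; rewrite /= /resonance_adj neij par.
Qed.

Lemma parallel_cone i j : cone resonance_graph i -> parallel i j.
Proof.
move=> /forallP/(_ j); rewrite /= /resonance_adj.
by case: eqVneq => [->|_] //= _; exact: parallel_refl.
Qed.

(* If [lam 0 j = 0], then [j] being noncone provides eta in Z with
   [eta 0 j != 0], which forces [lam 0 i = lam 0 m = 0]. *)
Lemma parallel_trans i j m : j \in noncone resonance_graph ->
  parallel i j -> parallel j m -> parallel i m.
Proof.
rewrite inE => /forallPn[p]; rewrite negb_imply /= /resonance_adj => /andP[nepj].
rewrite eq_sym nepj /= => /subvPn[eta Zeta]; rewrite memv_ker lfunE /= /minor2.
move=> minor0 /parallelP ij /parallelP jm; apply/parallelP => xi Zxi.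
have [lamj0|lamjN0] := eqVneq (lam 0 j) 0; last first.
  apply: (mulfI lamjN0); have e1 := ij _ Zxi; have e2 := jm _ Zxi.
  by rewrite mulrCA e2 mulrCA e1 mulrCA.
have etaj : eta 0 j != 0.
  by apply: contraNneq minor0 => etaj0; rewrite lamj0 etaj0 mul0r mulr0 subrr.
have lam0 q : lam 0 q * eta 0 j = lam 0 j * eta 0 q -> lam 0 q = 0.
  by rewrite lamj0 mul0r => /eqP; rewrite mulf_eq0 (negPf etaj) orbF => /eqP.
rewrite (lam0 i) ?(ij _ Zeta) // (lam0 m) ?mul0r //.
by rewrite -(jm _ Zeta).
Qed.

Lemma resonance_graph_neighborly : neighborly resonance_graph (lines H).
Proof.
move=> X S; set U := noncone resonance_graph => linX XU2 blS XUS.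
have /maxsetP[/resonance_cliqueP clS maxS] := blS.
(* Maximality of the block: a vertex parallel to all of [S] can be adjoined to it. *)
have addS v : {in S, forall s, parallel v s} -> v \in S.
  move=> vS; suff <- : v |: S = S by rewrite setU11.
  apply: maxS (subsetUr _ _); apply/resonance_cliqueP => i j.
  rewrite !inE => /orP[/eqP->|Si] /orP[/eqP->|Sj]; first exact: parallel_refl.
  - exact: vS.
  - by rewrite parallel_sym vS.
  exact: clS.
apply/subsetP => v Xv; have [Uv|] := boolP (v \in U); last first.
  by rewrite inE negbK => cv; apply: addS => s _; apply: parallel_cone.
apply: contraT => nSv.
(* [S] misses [v] but at most one element of [X :&: U], so it contains all the others; as [X :&: U]
   has at least two elements, some [y] remains. *)
have XUSv : X :&: U :&: S = (X :&: U) :\ v.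
  apply/eqP; rewrite eqEcard; apply/andP; split.
    apply/subsetP => i; rewrite !inE => /andP[-> Si]; rewrite andbT.
    by apply: contraNneq nSv => <-.
  by move: XUS; rewrite (cardsD1 v (X :&: U)) !in_setI Xv Uv /=; lia.
have /card_gt0P[y] : (0 < #|X :&: U :&: S|)%N by lia.
rewrite !in_setI => /andP[/andP[Xy Uy] Sy].
suff vy : parallel v y.
  by case/negP: nSv; apply: addS => s Ss; apply: parallel_trans Uy vy (clS _ _ Sy Ss).
(* Written as a sum over [X], (L) at [y] is a sum of minors of [i] and [y]. For [i != v] they
   vanish, as [i] is a cone vertex or lies in [S] with [y]; only the minor of [v] and [y] is
   left. *)
apply/parallelP => eta Zeta; have := annihilator_line Zeta linX Xy.
move/eqP; rewrite -subr_eq0 /coord_sum !mulr_suml -sumrB (bigD1 v) //= big1 ?addr0.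
  by rewrite subr_eq0 => /eqP->; rewrite mulrC.
move=> i /andP[Xi neiv]; suff /parallelP/(_ _ Zeta) : parallel i y.
  by move=> ->; rewrite mulrC subrr.
have [Ui|] := boolP (i \in U); last by rewrite inE negbK; apply: parallel_cone.
have : i \in X :&: U :&: S by rewrite XUSv in_setD1 in_setI neiv Xi.
by rewrite !in_setI => /andP[_ Si]; apply: clS.
Qed.

Lemma mem_annihilator_self : lam \in Z.
Proof. by rewrite mem_annihilator; apply/os_form_mul_eq0P. Qed.

Lemma annihilator_sub_Kspace : (Z <= Kspace resonance_graph (lines H) k)%VS.
Proof.
apply/subvP => eta Zeta; apply/mem_Kspace => X.
rewrite inE => /and3P[linX _ /resonance_cliqueP nclX].
(* If [lam] had nonzero sum on [X], (L) would make every [xi] in [Z] proportional to [lam] on [X],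
   and [X] would be a clique. *)
have lamX0 : coord_sum X lam = 0.
  apply/eqP; apply: contra_notT nclX => lamX i j Xi Xj; apply/parallelP => xi Zxi.
  apply: (mulfI lamX); rewrite [LHS]mulrCA [RHS]mulrCA.
  by rewrite !(annihilator_line Zxi linX) // mulrCA [RHS]mulrCA [lam 0 i * _]mulrC.
(* With the sum of [lam] zero and that of [eta] nonzero, (L) forces [lam] to vanish on [X], so all
   minors vanish and [X] is again a clique. *)
apply/eqP; apply: contra_notT nclX => etaX i j Xi Xj; apply/parallelP => xi Zxi.
have lam0 q : q \in X -> lam 0 q = 0.
  move=> Xq; have /eqP := annihilator_line Zeta linX Xq.
  by rewrite lamX0 mul0r eq_sym mulf_eq0 (negPf etaX) => /eqP.
by rewrite !lam0 ?mul0r.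
Qed.

Lemma annihilator_sub_Zspace : (Z <= Zspace resonance_graph (lines H) lam)%VS.
Proof.
apply/subvP => eta Zeta; apply/mem_Zspace.
split=> [|i j /andP[_ /parallelP par]]; last by rewrite par ?subrr.
exact: (subvP annihilator_sub_Kspace).
Qed.

Lemma Zspace_sub_annihilator (G : graph n) : neighborly G (lines H) ->
  lam \in Kspace G (lines H) k -> (Zspace G (lines H) lam <= Z)%VS.
Proof.
move=> nbG Klam; apply/subvP => eta /mem_Zspace[Keta minors].
rewrite mem_annihilator; apply/os_form_mul_eq0P => X i linX Xi.
have [clX|nclX] := boolP (clique G X).
  rewrite /coord_sum !mulr_suml; apply: eq_bigr => j Xj.
  have [->|neji] := eqVneq j i; first by rewrite mulrC.
  have Gji : G j i by move/forall_inP/(_ _ Xj)/forall_inP/(_ _ Xi): clX; rewrite neji.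
  have /eqP := minors _ _ Gji; rewrite subr_eq0 => /eqP->.
  by rewrite mulrC.
have [X3|] := leqP 3 #|X|.
  have XX : X \in nonclique_lines G (lines H) by rewrite inE linX X3.
  have /mem_Kspace/(_ X XX)-> := Klam.
  by have /mem_Kspace/(_ X XX)-> := Keta; rewrite !mul0r.
(* A nonclique line with two points [p], [q] is not controlled by [Kspace], so it must be excluded.
   Its points are nonadjacent, hence both noncone. *)
rewrite ltnS => X2; exfalso; move: (linX).
rewrite inE => /existsP[p /existsP[q /andP[nepq /eqP defX]]].
have Xpq : X = [set p; q].
  apply/esym/eqP; rewrite eqEcard cards2 nepq X2 andbT subUset !sub1set.
  by rewrite defX mem_line_l mem_line_r.
have nGpq : ~~ G p q.
  apply: contra nclX => Gpq; apply/forall_inP => a; rewrite Xpq !inE => Xa.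
  apply/forall_inP => b; rewrite !inE => Xb; apply/implyP.
  by case/orP: Xa => /eqP->; case/orP: Xb => /eqP->; rewrite ?eqxx // adj_sym.
have Up : p \in noncone G.
  by rewrite inE; apply/forallPn; exists q; rewrite eq_sym nepq.
have Uq : q \in noncone G.
  by rewrite inE; apply/forallPn; exists p; rewrite nepq adj_sym.
have XU : X :&: noncone G = X.
  by apply/setIidPl; rewrite Xpq subUset !sub1set Up Uq.
(* Extend [p] to a block [S]. It meets [X] in at least one of its two noncone points, so
   neighborliness puts [q] in [S], contradicting nonadjacency. *)
have : clique G [set p].
  by apply/forall_inP => a /set1P->; apply/forall_inP => b /set1P->; rewrite eqxx.
case/maxset_exists => S blS; rewrite sub1set => Sp.
have /subsetP sXS : X \subset S.
  apply: (nbG X S) => //; rewrite XU Xpq cards2 nepq //.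
  by apply/card_gt0P; exists p; rewrite !inE eqxx.
have [/forall_inP/(_ p Sp)/forall_inP/(_ q) clpq _] := maxsetP blS.
by move: nGpq; rewrite (implyP (clpq _)) // sXS // Xpq set22.
Qed.

End ResonanceGraph.

Theorem theorem2p13 (R : realType) (kk : fieldType) (l n k : nat)
    (H : arrangement (complex R) l n) (hk : (1 <= k)%N) :
  resonance H kk k =
  (\bigcup_(G in neighborly_graphs H kk) Vset H kk G k)%classic.
Proof.
apply/seteqP; split=> lam /= => [Zk|[G [nbG _] [Klam Zk]]].
  exists (resonance_graph H lam); first split.
  - exact: resonance_graph_neighborly.
  (* The bound 2 comes from [k.+1] with [k] at least 1. *)
  - apply: leq_trans (dimvS (annihilator_sub_Kspace H lam)).
    by apply: leq_trans Zk; rewrite ltnS.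
  split; first exact: (subvP (annihilator_sub_Kspace H lam)) (mem_annihilator_self H lam).
  by apply: leq_trans Zk (dimvS (annihilator_sub_Zspace H lam)).
by apply: leq_trans Zk (dimvS (Zspace_sub_annihilator nbG Klam)).
Qed.
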